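(* Let $I=(G=(V,E),\mathcal{C},\omega,\ell,b)$ be an instance of \textsc{Stars NWS} and $E^*\subseteq E$. Let $C\in\mathcal{C}$ be a community containing no local edge (no edge of $E^*$ has both endpoints in $C$), and let $D\in\mathcal{C}$ with $|C\cap D|\ge 2$. Then for every solution $G'$ with $\mathrm{univ}_{G'}(C)\not\subseteq C\cap D$, the communities $C$ and $D$ induce a local cycle in $G'$ that uses at least one edge not in $E^*$.
   Context: A solution of \textsc{Stars NWS} is a spanning subgraph $G'=(V,E')$, $E'\subseteq E$, $|E'|\le\ell$, $\omega(E')\le b$, such that for each $C\in\mathcal{C}$ the set $\mathrm{univ}_{G'}(C)$ of vertices $u\in C$ adjacent in $G'$ to all of $C\setminus\{u\}$ is nonempty. Edges of $E^*$ are called local edges. Two communities $C_1,C_2$ induce a local cycle in $G'$ if there are $c_i\in\mathrm{univ}_{G'}(C_i)$ ($i=1,2$) such that the graph on $C_1\cup C_2$ with edges $\{\{c_i,w\}: w\in C_i\setminus\{c_i\}, i\in\{1,2\}\}$ contains a cycle; such cycles are local cycles. *)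

(* Defs.v *)
From mathcomp Require Import all_boot all_order all_algebra.
Set Implicit Arguments.
Unset Strict Implicit.
Unset Printing Implicit Defensive.

Import Order.TTheory GRing.Theory Num.Theory.

(* The vertex set is the finite type V; a finite simple graph on V is given by
   its edge set, a set of two-element sets of vertices. *)

(* Weights are total on {set V}; only values on edges are ever used. *)
Record stars_nws (V : finType) (R : realDomainType) := StarsNWS {
  edges : {set {set V}};
  edges_card2 : forall e, e \in edges -> #|e| = 2;
  communities : {set {set V}};
  weight : {set V} -> R;
  max_edges : nat;
  budget : R
}.

Definition univ (V : finType) (E' : {set {set V}}) (C : {set V}) : {set V} :=
  [set u in C | [forall w in C :\ u, [set u; w] \in E']].

(* The spanning subgraph (V, E') is identified with its edge set E'. *)
Definition solution (V : finType) (R : realDomainType) (I : stars_nws V R)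
    (E' : {set {set V}}) : Prop :=
  [/\ E' \subset edges I,
      #|E'| <= max_edges I,
      (\sum_(e in E') weight I e <= budget I)%R
    & forall C, C \in communities I -> univ E' C != set0].

Definition star_edges (V : finType) (c : V) (C : {set V}) : {set {set V}} :=
  [set [set c; w] | w in C :\ c].

(* p lists the pairwise distinct vertices of a cycle of the graph (U, F), in
   cyclic order. *)
Definition is_cycle (V : finType) (U : {set V}) (F : {set {set V}})
    (p : seq V) : Prop :=
  [/\ 2 < size p, {subset p <= U} & ucycle (fun x y => [set x; y] \in F) p].

Definition cycle_edges (V : finType) (p : seq V) : {set {set V}} :=
  [set [set x; next p x] | x in p].

Definition local_cycle (V : finType) (E' : {set {set V}}) (C1 C2 : {set V})
    (p : seq V) : Prop :=
  exists c1 c2 : V,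
    [/\ c1 \in univ E' C1, c2 \in univ E' C2
      & is_cycle (C1 :|: C2) (star_edges c1 C1 :|: star_edges c2 C2) p].

(* Main.v *)
(** Take a centre [c] of [C] outside [D] and any centre [d] of [D].  If [d] lies
    in [C], then [c], [d] and a second common vertex form a triangle; otherwise
    [c], [x], [d], [y] form a 4-cycle for any two common vertices [x], [y].
    Either cycle starts with an edge from [c] to a vertex of [C], which is
    contained in [C] and hence not local. *)
Require Import Defs.
From mathcomp Require Import all_boot all_order all_algebra.

Lemma mem_univ (V : finType) (E' : {set {set V}}) (C : {set V}) (u : V) :
  u \in univ E' C -> u \in C.
Proof. by rewrite inE => /andP[]. Qed.

Lemma star_edge (V : finType) (c w : V) (C : {set V}) :
  w \in C -> w != c -> [set c; w] \in star_edges c C.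
Proof. by move=> wC wc; apply: imset_f; rewrite !inE wc. Qed.

Lemma cycle_edge_head (V : finType) (x y : V) (p : seq V) :
  [set x; y] \in cycle_edges [:: x, y & p].
Proof. by apply/imsetP; exists x; rewrite ?mem_head //= eqxx. Qed.

(** The two edges at [c] come from the star of [C], because [d] and [y] lie in [C]; the edge joining
    [d] to [y] comes from the star of [D]. As [c] is outside [D], it differs from both. *)
Lemma star_triangle (V : finType) (C D : {set V}) (c d y : V) :
  c \in C -> c \notin D -> d \in C :&: D -> y \in C :&: D -> y != d ->
  is_cycle (C :|: D) (star_edges c C :|: star_edges d D) [:: c; d; y].
Proof.
move=> cC cD /setIP[dC dD] /setIP[yC yD] yd.
have dc : d != c by apply: contraNneq cD => <-.
have yc : y != c by apply: contraNneq cD => <-.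
split=> //.
  by move=> z; rewrite !inE => /or3P[] /eqP->; rewrite ?cC ?dC ?yC.
(* The closing edge is listed from [y] to [c]; it is flipped so that the centre comes first, as in
   [star_edges]. *)
rewrite /ucycle /= !in_setU (setUC [set y]) !star_edge ?orbT //=.
by rewrite !inE !negb_or !andbT ![c == _]eq_sym dc yc eq_sym yd.
Qed.

(** Each of [x] and [y] is joined to [c] by the star of [C] and to [d] by the star of [D]. Each
    centre lies outside the other community, so it differs from the other centre and from the common
    vertices. *)
Lemma star_square (V : finType) (C D : {set V}) (c d x y : V) :
  c \in C -> c \notin D -> d \in D -> d \notin C ->
  x \in C :&: D -> y \in C :&: D -> x != y ->
  is_cycle (C :|: D) (star_edges c C :|: star_edges d D) [:: c; x; d; y].
Proof.
move=> cC cD dD dC /setIP[xC xD] /setIP[yC yD] xy.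
have dc : d != c by apply: contraNneq cD => <-.
have xc : x != c by apply: contraNneq cD => <-.
have yc : y != c by apply: contraNneq cD => <-.
have xd : x != d by apply: contraNneq dC => <-.
have yd : y != d by apply: contraNneq dC => <-.
split=> //.
  by move=> z; rewrite !inE => /or4P[] /eqP->; rewrite ?cC ?dD ?xC ?yC ?orbT.
rewrite /ucycle /= !in_setU (setUC [set y]) (setUC [set x]) !star_edge ?orbT //=.
by rewrite !inE !negb_or !andbT ![c == _]eq_sym dc xc yc xd xy eq_sym yd.
Qed.

Theorem lemma14 (V : finType) (R : realDomainType) (I : stars_nws V R)
    (Estar : {set {set V}}) (C D : {set V})
    (hEstar : Estar \subset edges I)
    (hC : C \in communities I)
    (hlocal : forall e : {set V}, e \in Estar -> ~~ (e \subset C))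
    (hD : D \in communities I)
    (hCD : 2 <= #|C :&: D|) :
  forall E' : {set {set V}}, solution I E' ->
    ~~ (univ E' C \subset C :&: D) ->
    exists p : seq V,
      local_cycle E' C D p /\
      exists e : {set V}, e \in cycle_edges p /\ e \notin Estar.
Proof.
move=> E' [_ _ _ /(_ D hD)/set0Pn[d dU]] /subsetPn[c cU].
have cC := mem_univ _ _ _ _ cU; have dD := mem_univ _ _ _ _ dU.
rewrite inE cC /= => cD.
have not_local z : z \in C -> [set c; z] \notin Estar.
  by move=> zC; apply: contraL (hlocal [set c; z]) _; rewrite subUset !sub1set cC.
have [dC|dC] := boolP (d \in C).
- have dCD : d \in C :&: D by rewrite inE dC.
  have [y yCD yd] : exists2 y, y \in C :&: D & y != d.
    have [x [y [xCD yCD xy]]] := card_gt1P hCD.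
    (* Of two distinct common vertices, at least one is not [d]. *)
    by have [xd|xd] := eqVneq x d; [exists y; rewrite // -xd eq_sym | exists x].
  exists [:: c; d; y]; split; first by exists c, d; split=> //; apply: star_triangle.
  (* Here [d] itself lies in [C], so the first edge of the triangle is inside [C]. *)
  by exists [set c; d]; rewrite cycle_edge_head not_local.
- have [x [y [xCD yCD xy]]] := card_gt1P hCD.
  exists [:: c; x; d; y].
  split; first by exists c, d; split=> //; apply: star_square.
  by exists [set c; x]; rewrite cycle_edge_head not_local //; case/setIP: xCD.
Qed.
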